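(* Let $H=\mathbb{R}^n$ or $H=\mathbb{C}^n$, let $\mathcal{F}=\{f_1,\ldots,f_m\}$ be a spanning set of $m$ vectors in $H$, and let $\varphi:\hat{H}\to(\mathbb{R}^+)^m$ be the map $\varphi(\hat{x})=(|\langle x,f_k\rangle|^2)_{1\le k\le m}$. Consider the following conditions (which are equivalent to each other): (a) For any disjoint partition $\mathcal{F}=\mathcal{F}_1\cup\mathcal{F}_2$, either $\mathcal{F}_1$ spans $H$ or $\mathcal{F}_2$ spans $H$. (b) For any two vectors $x,y\in H$, if $x\neq 0$ and $y\neq 0$ then $\sum_{k=1}^m |\langle x,f_k\rangle|^2|\langle y,f_k\rangle|^2>0$. (c) There is a real constant $a_0>0$ such that for all $x,y\in H$, $\sum_{k=1}^m |\langle x,f_k\rangle|^2|\langle y,f_k\rangle|^2\geq a_0\|x\|^2\|y\|^2$. (d) There is a real constant $a_0>0$ such that for all $x\in H$, $\sum_{k=1}^m |\langle x,f_k\rangle|^2\,\langle\cdot,f_k\rangle f_k\geq a_0\|x\|^2 I$ in the sense of quadratic forms. Then: (1) When $H=\mathbb{R}^n$, $\varphi$ is injective if and only if any (and hence all) of the conditions (a)–(d) is satisfied. (2) When $H=\mathbb{C}^n$, if $\varphi$ is injective then all of the conditions (a)–(d) hold.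
   Context: $H$ is the $n$-dimensional Hilbert space $\mathbb{R}^n$ or $\mathbb{C}^n$ ($n\ge 1$) with its standard scalar product $\langle\cdot,\cdot\rangle$ (linear in the first argument) and norm $\|\cdot\|$. On $H$, $x\sim y$ iff $y=zx$ for some scalar $z$ (real if $H=\mathbb{R}^n$, complex if $H=\mathbb{C}^n$) with $|z|=1$; $\hat{H}=H/\sim$ is the set of equivalence classes and $\hat{x}$ is the class of $x$. $\mathbb{R}^+$ denotes the set of nonnegative real numbers. The map $\varphi$ is well defined on classes. The operator $\langle\cdot,f_k\rangle f_k$ maps $z\in H$ to $\langle z,f_k\rangle f_k$, $I$ is the identity operator, and $A\ge B$ in the sense of quadratic forms means $\langle Az,z\rangle\geq\langle Bz,z\rangle$ for all $z\in H$. In a disjoint partition a part is allowed to be empty. *)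

(* Defs.v *)
From mathcomp Require Import all_boot all_order all_algebra.
From mathcomp Require Import interval_inference generic_quotient.
From mathcomp Require Import boolp.

Set Implicit Arguments.
Unset Strict Implicit.
Unset Printing Implicit Defensive.

Import Order.TTheory GRing.Theory Num.Theory.

Local Open Scope ring_scope.
Local Open Scope quotient_scope.

(* The definitions below are shared by H = R^n (K the reals, cj the identity) *)
(* and H = C^n (K the complex numbers, cj the complex conjugation).  As usual *)
(* in MathComp, norms take their values in K, and 0 <= a in the complex       *)
(* numbers means that a is a nonnegative real; {nonneg K} is thus R^+ in both *)
(* cases.                                                                     *)

Section Space.
Variables (K : numFieldType) (cj : K -> K) (n : nat).

Let H := 'cV[K]_n.

Definition dot (x y : H) : K := \sum_i x i 0 * cj (y i 0).

(* The square of the Euclidean norm; `|x| on matrices would be the sup norm.  *)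
Definition sqnorm (x : H) : K := dot x x.

(* A >= B in the sense of quadratic forms; over the complex numbers, <= also  *)
(* forces the difference of both sides to be real.                            *)
Definition qform_ge (A B : H -> H) : Prop :=
  forall z : H, dot (B z) z <= dot (A z) z.

Definition phase_eqb (x y : H) : bool :=
  `[< exists2 z : K, `|z| = 1 & y = z *: x >].

Lemma phase_eqb_equiv : equiv_class_of phase_eqb.
Proof.
have norm1_neq0 (z : K) : `|z| = 1 -> z != 0.
  by move=> z1; rewrite -normr_eq0 z1 oner_eq0.
have sym (x y : H) : phase_eqb x y -> phase_eqb y x.
  move=> /asboolP[z z1 ->]; apply/asboolP; exists z^-1.
    by rewrite normfV z1 invr1.
  by rewrite scalerA mulVf ?scale1r ?norm1_neq0.
split=> [x|x y|y x w /asboolP[z z1 ->] /asboolP[t t1 ->]].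
- by apply/asboolP; exists 1; rewrite ?normr1 ?scale1r.
- by apply/idP/idP; apply: sym.
- by apply/asboolP; exists (t * z); rewrite ?normrM ?t1 ?z1 ?mulr1 ?scalerA.
Qed.

Canonical phase_eqb_equiv_rel := EquivRelPack phase_eqb_equiv.

Definition Hhat : Type := {eq_quot phase_eqb}.

Variables (m : nat) (f : 'I_m -> H).

Definition measurement (x : H) : {ffun 'I_m -> {nonneg K}} :=
  [ffun k => (`|dot x (f k)| ^+ 2)%:nng].

Definition phi (xh : Hhat) : {ffun 'I_m -> {nonneg K}} :=
  measurement (repr (xh : {eq_quot phase_eqb})).

(* phi does not depend on the choice of representatives.                      *)
Lemma phi_pi (x : H) : phi (\pi_({eq_quot phase_eqb}) x) = measurement x.
Proof.
rewrite /phi; case: piP => y /eqmodP /asboolP[z z1 ->].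
apply/ffunP => k; rewrite !ffunE; apply/val_inj => /=.
have -> : dot (z *: x) (f k) = z * dot x (f k).
  by rewrite /dot mulr_sumr; apply: eq_bigr => i _; rewrite mxE mulrA.
by rewrite normrM z1 mul1r.
Qed.

(* The subfamily of f indexed by A spans H.                                   *)
Definition spans (A : {set 'I_m}) : Prop :=
  <<[seq f k | k in A]>>%VS = fullv.

Definition cond_a : Prop :=
  forall A B : {set 'I_m},
    A :|: B = setT -> [disjoint A & B] -> spans A \/ spans B.

Definition cond_b : Prop :=
  forall x y : H, x != 0 -> y != 0 ->
    0 < \sum_k `|dot x (f k)| ^+ 2 * `|dot y (f k)| ^+ 2.

Definition cond_c : Prop :=
  exists a0 : K, [/\ a0 \is Num.real, 0 < a0 &
    forall x y : H,
      a0 * sqnorm x * sqnorm y <=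
        \sum_k `|dot x (f k)| ^+ 2 * `|dot y (f k)| ^+ 2].

Definition cond_d : Prop :=
  exists a0 : K, [/\ a0 \is Num.real, 0 < a0 &
    forall x : H,
      qform_ge
        (fun z => \sum_k `|dot x (f k)| ^+ 2 *: (dot z (f k) *: f k))
        (fun z => (a0 * sqnorm x) *: z)].

End Space.

(* Main.v *)
(* If neither part of a partition spans, choose u <> 0 orthogonal to the first  *)
(* part and v <> 0 orthogonal to the second: then u and v violate (b), and      *)
(* u + v, u - v have the same measurements, although u + v = z (u - v) would    *)
(* make u and v proportional, hence orthogonal to the whole spanning family.    *)
(* Conversely, over the reals, equal measurements of x and y say that every     *)
(* f_k is orthogonal to x + y or to x - y.  For (a) -> (c) no compactness is    *)
(* needed: by (a), the f_k at which |<x,f_k>|^2 is at least a fixed small       *)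
(* multiple of |x|^2 span, as the remaining ones would violate a lower frame    *)
(* bound common to the finitely many spanning subfamilies.                      *)
Require Import Defs.
From mathcomp Require Import all_boot all_order all_algebra.
From mathcomp Require Import reals complex.
From mathcomp Require Import interval_inference generic_quotient boolp.
From mathcomp Require Import ring.

Set Implicit Arguments.
Unset Strict Implicit.
Unset Printing Implicit Defensive.

Local Open Scope ring_scope.
Local Open Scope complex_scope.

Import Order.TTheory GRing.Theory Num.Theory.

(** Both scalar fields are treated at once through an involutive [cj] with [z * cj z = |z|^2], which
    makes [sqnorm] positive definite. The equivalences follow from the cycle (a) -> (c) -> (b) ->
    (a) ([cond_ac], [cond_cb], [cond_ba]), while (c) and (d) are one inequality ([cond_cd]). The
    quantitative input to (c) is [uniform_frame], a consequence of Cauchy-Schwarz. Injectivity gives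
    (a) over either field ([injective_cond_a]); the converse [real_cond_a_injective] needs that real
    numbers of equal modulus differ only by a sign. *)

Lemma cauchy_schwarz_sum (K : numFieldType) (I : finType) (A : {pred I})
    (a b : I -> K) :
  `|\sum_(k in A) a k * b k| ^+ 2 <=
    (\sum_(k in A) `|a k| ^+ 2) * (\sum_(k in A) `|b k| ^+ 2).
Proof.
apply: (@le_trans _ _ ((\sum_(k in A) `|a k| * `|b k|) ^+ 2)).
  have le_norm : `|\sum_(k in A) a k * b k| <= \sum_(k in A) `|a k| * `|b k|.
    by apply: le_trans (ler_norm_sum _ _ _) _; under eq_bigr do rewrite normrM.
  by rewrite lerXn2r // nnegrE // (le_trans _ le_norm).
(* Lagrange's identity: doubling and symmetrising the double sums turns the difference into a sum of
   squares. *)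
rewrite -(ler_pM2l (ltr0Sn K 1)) !mulr_natl !mulr2n expr2 !big_distrlr /=.
rewrite [X in _ <= X + _]exchange_big -!big_split /=.
apply: ler_sum => j _; rewrite -!big_split /=; apply: ler_sum => k _.
rewrite -subr_ge0.
set x := `|a j|; set y := `|b j|; set z := `|a k|; set t := `|b k|.
have -> : z ^+ 2 * y ^+ 2 + x ^+ 2 * t ^+ 2 - (x * y * (z * t) + x * y * (z * t))
  = (z * y - x * t) ^+ 2 by ring.
by rewrite real_exprn_even_ge0 // rpredB // rpredM // normr_real.
Qed.

Section Frames.
Variables (K : numFieldType) (cj : {rmorphism K -> K}).
Hypotheses (cjK : involutive cj) (mul_cj : forall z, z * cj z = `|z| ^+ 2).
Variable n : nat.
Implicit Types x y z u v w : 'cV[K]_n.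

Local Notation dot := (dot cj).
Local Notation sqnorm := (sqnorm cj).

Lemma dotDl x y w : dot (x + y) w = dot x w + dot y w.
Proof. by rewrite -big_split; apply: eq_bigr => i _; rewrite mxE mulrDl. Qed.

Lemma dotZl a x w : dot (a *: x) w = a * dot x w.
Proof. by rewrite mulr_sumr; apply: eq_bigr => i _; rewrite mxE mulrA. Qed.

Lemma dotNl x w : dot (- x) w = - dot x w.
Proof. by rewrite -scaleN1r dotZl mulN1r. Qed.

Lemma dotBl x y w : dot (x - y) w = dot x w - dot y w.
Proof. by rewrite dotDl dotNl. Qed.

Lemma dot0l w : dot 0 w = 0.
Proof. by rewrite -(scale0r 0) dotZl mul0r. Qed.

Lemma dot_suml (I : Type) (r : seq I) (P : pred I) (F : I -> 'cV[K]_n) w :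
  dot (\sum_(k <- r | P k) F k) w = \sum_(k <- r | P k) dot (F k) w.
Proof. by elim/big_rec2: _ => [|k s x _ <-]; rewrite ?dot0l ?dotDl. Qed.

Lemma dotC x y : cj (dot x y) = dot y x.
Proof.
by rewrite rmorph_sum; apply: eq_bigr => i _; rewrite rmorphM cjK mulrC.
Qed.

Lemma dot_sumr (I : Type) (r : seq I) (P : pred I) (F : I -> 'cV[K]_n) x :
  dot x (\sum_(k <- r | P k) F k) = \sum_(k <- r | P k) dot x (F k).
Proof. by rewrite -dotC dot_suml rmorph_sum; under eq_bigr do rewrite dotC. Qed.

Lemma dotZr a x w : dot x (a *: w) = cj a * dot x w.
Proof. by rewrite -dotC dotZl rmorphM dotC. Qed.

Lemma dot_delta x i : dot x (delta_mx i 0) = x i 0.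
Proof.
rewrite /Defs.dot (bigD1 i) //= mxE !eqxx rmorph1 mulr1 big1 ?addr0 // => j ji.
by rewrite mxE (negbTE ji) rmorph0 mulr0.
Qed.

Lemma sqnormE x : sqnorm x = \sum_i `|x i 0| ^+ 2.
Proof. by apply: eq_bigr => i _; rewrite mul_cj. Qed.

Lemma sqnorm_ge0 x : 0 <= sqnorm x.
Proof. by rewrite sqnormE sumr_ge0 // => i _; rewrite exprn_ge0. Qed.

Lemma sqnorm_eq0 x : (sqnorm x == 0) = (x == 0).
Proof.
apply/idP/eqP => [|->]; last by rewrite /Defs.sqnorm dot0l.
rewrite sqnormE psumr_eq0 => [/allP x0|i _]; last by rewrite exprn_ge0.
apply/colP => i; rewrite mxE; apply/eqP.
by have := x0 i (mem_index_enum _); rewrite sqrf_eq0 normr_eq0.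
Qed.

Lemma sqnorm_gt0 x : (0 < sqnorm x) = (x != 0).
Proof. by rewrite lt0r sqnorm_ge0 sqnorm_eq0 andbT. Qed.

Lemma exists_orthogonal (U : {vspace 'cV[K]_n}) :
  U != fullv -> exists2 x, x != 0 & forall w, w \in U -> dot x w = 0.
Proof.
move=> Uproper.
have dimU : (\dim U < n)%N.
  rewrite ltnNge; apply: contra Uproper => dU.
  by rewrite eqEdim subvf dimvf dim_matrix mulr1.
(* With more rows than columns, [M] has a nonzero left kernel vector; [u *m M = 0] says that [u^T]
   is orthogonal to a basis of [U]. *)
pose M : 'M[K]_(n, \dim U) := \matrix_(i, j) cj ((vbasis U)`_j i 0).
have /rowV0Pn[u /sub_kermxP uM u0] : kermx M != 0.
  by rewrite -mxrank_eq0 mxrank_ker -lt0n subn_gt0 (leq_ltn_trans (rank_leq_col _)).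
exists u^T; first by apply: contra u0 => /eqP u0; rewrite -(trmxK u) u0 trmx0.
move=> w /coord_vbasis ->; rewrite dot_sumr big1 // => j _; rewrite dotZr.
have := congr1 (fun A : 'rV_(\dim U) => A 0 j) uM; rewrite !mxE => uMj.
suff -> : dot u^T (vbasis U)`_j = 0 by rewrite mulr0.
by rewrite -[RHS]uMj; apply: eq_bigr => i _; rewrite !mxE.
Qed.

Variables (m : nat) (f : 'I_m -> 'cV[K]_n).
Implicit Types A B : {set 'I_m}.

Lemma not_spans_orthogonal A : ~ spans f A ->
  exists2 x, x != 0 & forall k, k \in A -> dot x (f k) = 0.
Proof.
move=> /eqP /exists_orthogonal[x x0 xA]; exists x => // k kA.
by apply/xA/memv_span/image_f.
Qed.

Lemma spans_comb A w : spans f A ->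
  exists c : 'I_m -> K, w = \sum_(k in A) c k *: f k.
Proof.
move=> sA; have : w \in <<[seq f k | k in A]>>%VS by rewrite sA memvf.
rewrite span_def big_image /= => /memv_sumP[g gA ->].
have /choice[c gE] k : exists c, k \in A -> g k = c *: f k.
  have [kA|_] := boolP (k \in A); last by exists 0.
  by have /vlineP[c ->] := gA k kA; exists c.
by exists c; apply: eq_bigr.
Qed.

(** The coordinates of x are its products with the standard basis vectors; expanding these in the
    [f k] and applying Cauchy-Schwarz bounds each coordinate. *)
Lemma spans_frame A : spans f A ->
  exists M : K, forall x,
    sqnorm x <= M * \sum_(k in A) `|dot x (f k)| ^+ 2.
Proof.
move=> sA; have /choice[c cE] i := spans_comb (delta_mx i 0) sA.
exists (\sum_i \sum_(k in A) `|cj (c i k)| ^+ 2) => x.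
rewrite sqnormE mulr_suml; apply: ler_sum => i _.
rewrite -dot_delta cE dot_sumr; under eq_bigr do rewrite dotZr.
exact: cauchy_schwarz_sum.
Qed.

Lemma uniform_frame : exists2 M : K, 0 < M & forall A x, spans f A ->
  sqnorm x <= M * \sum_(k in A) `|dot x (f k)| ^+ 2.
Proof.
have /choice[M ME] A : exists M : K, spans f A -> forall x,
    sqnorm x <= M * \sum_(k in A) `|dot x (f k)| ^+ 2.
  have [/spans_frame[M ME]|nsA] := pselect (spans f A); last by exists 0.
  by exists M.
(* [K] is only partially ordered, so a sum of norms replaces the maximum over subsets; the 1 ensures
   positivity. *)
have le1 A : `|M A| <= 1 + \sum_B `|M B|.
  by rewrite (bigD1 A) //= addrCA lerDl addr_ge0 // sumr_ge0.
exists (1 + \sum_B `|M B|) => [|A x /ME {}ME].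
  by rewrite ltr_pwDl // sumr_ge0.
have s0 : 0 <= \sum_(k in A) `|dot x (f k)| ^+ 2.
  by rewrite sumr_ge0 // => k _; rewrite exprn_ge0.
rewrite -(ger0_norm (sqnorm_ge0 x)).
apply: le_trans (ler_wpM2r s0 (le1 A)).
rewrite -[X in _ <= _ * X]ger0_norm // -normrM.
by rewrite !ger0_norm ?sqnorm_ge0 ?(le_trans _ (ME x)) ?sqnorm_ge0.
Qed.

Lemma spans_eq0 A x : spans f A -> (forall k, k \in A -> dot x (f k) = 0) ->
  x = 0.
Proof.
move=> /spans_frame[M ME] xA; apply/eqP; rewrite -sqnorm_eq0.
rewrite eq_le sqnorm_ge0 andbT; apply: le_trans (ME x) _.
by rewrite big1 ?mulr0 // => k /xA ->; rewrite normr0 expr0n.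
Qed.

Lemma cond_ac : cond_a f -> cond_c cj f.
Proof.
move=> cA; have [M M0 ME] := uniform_frame.
(* The factor m + 1 exceeds the size of any index set, so the set [A] of small coefficients cannot
   span: that would give (m + 1)|x|^2 <= m|x|^2. *)
pose L := M * m.+1%:R; have L0 : 0 < L by rewrite mulr_gt0.
have ML0 : 0 < M * L by rewrite mulr_gt0.
exists (M * L)^-1; split => [||x y].
- by rewrite gtr0_real ?invr_gt0.
- by rewrite invr_gt0.
have sq0 u k : 0 <= `|dot u (f k)| ^+ 2 by rewrite exprn_ge0.
have sqr u k : L * `|dot u (f k)| ^+ 2 \is Num.real.
  by rewrite ger0_real // mulr_ge0 // ltW.
have [->|x0] := eqVneq x 0.
  by rewrite /Defs.sqnorm dot0l mulr0 mul0r sumr_ge0 // => k _; rewrite mulr_ge0.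
pose A := [set k | L * `|dot x (f k)| ^+ 2 < sqnorm x].
have [sA|sA] : spans f A \/ spans f (~: A).
- by apply: cA; rewrite ?setUCr // -setI_eq0 setICr.
- have : m.+1%:R * sqnorm x <= m%:R * sqnorm x.
    apply: (@le_trans _ _ (\sum_(k in A) L * `|dot x (f k)| ^+ 2)).
      by rewrite -mulr_sumr /L [M * _]mulrC -mulrA ler_wpM2l ?ler0n ?ME.
    apply: (@le_trans _ _ (\sum_(k in A) sqnorm x)).
      by apply: ler_sum => k; rewrite inE => /ltW.
    rewrite sumr_const -[sqnorm x *+ _]mulr_natl ler_wpM2r ?sqnorm_ge0 // ler_nat.
    by rewrite -[X in (_ <= X)%N]card_ord max_card.
  by rewrite ler_pM2r ?sqnorm_gt0 // ler_nat ltnn.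
(* The complement of [A] spans: apply the frame bound to y there, use |x|^2 <= L |<x,f_k>|^2
   termwise, and discard the nonnegative terms over [A]. *)
rewrite -mulrA -(ler_pM2l ML0) mulVKf ?gt_eqF //.
apply: le_trans (ler_wpM2l (sqnorm_ge0 x) (ME _ y sA)) _.
rewrite mulrCA -mulrA ler_pM2l // !mulr_sumr.
rewrite [X in _ <= X](bigID (mem (~: A))) /=.
rewrite -[X in X <= _]addr0 lerD ?sumr_ge0 // => [|k _]; last first.
  by rewrite mulr_ge0 ?mulr_ge0 // ltW.
apply: ler_sum => k; rewrite !inE => kA; rewrite [X in _ <= X]mulrA.
apply: ler_wpM2r => //.
by rewrite real_leNgt // ger0_real // sqnorm_ge0.
Qed.

Lemma cond_cb : cond_c cj f -> cond_b cj f.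
Proof.
move=> [a [_ a0 cE]] x y x0 y0.
by apply: lt_le_trans (cE x y); rewrite !mulr_gt0 ?sqnorm_gt0.
Qed.

Lemma not_cond_a_orthogonal : ~ cond_a f ->
  exists x y, [/\ x != 0, y != 0 & forall k, dot x (f k) = 0 \/ dot y (f k) = 0].
Proof.
move=> /existsNP[A] /existsNP[B] /not_implyP[AB /not_implyP[_ /not_orP[]]].
move=> /not_spans_orthogonal[x x0 xA] /not_spans_orthogonal[y y0 yB].
exists x, y; split => // k; have : k \in A :|: B by rewrite AB inE.
by rewrite inE => /orP[/xA|/yB]; [left|right].
Qed.

Lemma cond_ba : cond_b cj f -> cond_a f.
Proof.
move=> cB; apply: contrapT => /not_cond_a_orthogonal[x [y [x0 y0 xy]]].
have := cB x y x0 y0; rewrite big1 ?ltxx // => k _.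
by case: (xy k) => ->; rewrite normr0 expr0n ?mul0r ?mulr0.
Qed.

(** This identifies the quadratic form in (d) with the sum in (c). *)
Lemma dot_frame_operator x z :
  dot (\sum_k `|dot x (f k)| ^+ 2 *: (dot z (f k) *: f k)) z =
  \sum_k `|dot x (f k)| ^+ 2 * `|dot z (f k)| ^+ 2.
Proof.
rewrite dot_suml; apply: eq_bigr => k _.
by rewrite !dotZl -[dot (f k) z]dotC mul_cj.
Qed.

Lemma cond_cd : cond_c cj f <-> cond_d cj f.
Proof.
split=> -[a [ar a0 cE]]; exists a; split=> // x y; have := cE x y.
  by rewrite dot_frame_operator dotZl.
by rewrite dot_frame_operator dotZl.
Qed.

Lemma injective_cond_a :
  spans f [set: 'I_m] -> injective (phi cj f) -> cond_a f.
Proof.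
move=> sf phi_inj; apply: contrapT => /not_cond_a_orthogonal[u [v [u0 v0 uv]]].
pose cls := (\pi_({eq_quot @phase_eqb K n}))%qT.
have : phi cj f (cls (u + v)) = phi cj f (cls (u - v)).
  rewrite !phi_pi; apply/ffunP => k; rewrite !ffunE; apply/val_inj => /=.
  rewrite dotBl dotDl; case: (uv k) => ->.
    by rewrite add0r sub0r normrN.
  by rewrite subr0 addr0.
move=> /phi_inj /eqmodP /asboolP[z z1 /eqP].
rewrite scalerDr -subr_eq0 => /eqP uvz.
have {}uvz : (1 - z) *: u = (1 + z) *: v.
  apply/eqP; rewrite -subr_eq0 -[X in _ == X]uvz !scalerBl !scalerDl !scale1r.
  by apply/eqP; rewrite !opprD !addrA; congr (_ - _); rewrite addrAC.
(* If z = 1, then 2v = 0. Otherwise <v,f_k> = 0 forces <u,f_k> = 0, so u is orthogonal to every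
   [f k]. *)
have orth : u = 0 \/ v = 0.
  have [z1E|z1N] := eqVneq (1 - z) 0.
    right; apply/eqP; move/eqP: uvz; rewrite z1E scale0r eq_sym scaler_eq0.
    by move: z1E => /eqP; rewrite subr_eq0 => /eqP <-; rewrite -mulr2n pnatr_eq0.
  left; apply: (spans_eq0 sf) => k _; case: (uv k) => // vk.
  apply/eqP; have := congr1 (fun w => dot w (f k)) uvz; rewrite !dotZl vk mulr0.
  by move/eqP; rewrite mulf_eq0 (negbTE z1N).
by case: orth => E; [rewrite E eqxx in u0 | rewrite E eqxx in v0].
Qed.

End Frames.

Lemma real_cond_a_injective (R : realFieldType) (n m : nat)
    (f : 'I_m -> 'cV[R]_n) :
  cond_a f -> injective (phi idfun f).
Proof.
move=> cA xh yh; rewrite -[xh]reprK -[yh]reprK; set x := repr xh; set y := repr yh.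
rewrite !phi_pi => xy; apply/eqmodP/asboolP.
have mulE (z : R) : z * idfun z = `|z| ^+ 2 by rewrite real_normK ?num_real.
(* Off [A], equality of real squares leaves only <x,f_k> = -<y,f_k>. Whichever part spans gives y =
   x or y = -x. *)
pose A := [set k | dot idfun (x - y) (f k) == 0].
have [sA|sA] : spans f A \/ spans f (~: A).
- by apply: cA; rewrite ?setUCr // -setI_eq0 setICr.
- exists 1; rewrite ?normr1 // scale1r; apply/esym/subr0_eq.
  by apply: (spans_eq0 _ mulE sA) => // k; rewrite inE => /eqP.
exists (-1); rewrite ?normrN1 // scaleN1r; apply/eqP.
rewrite eq_sym eqr_oppLR -addr_eq0; apply/eqP.
apply: (spans_eq0 _ mulE sA) => // k; rewrite !inE => kA.
have := congr1 (fun g : {ffun 'I_m -> {nonneg R}} => (g k)%:num) xy.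
rewrite !ffunE /= !real_normK ?num_real // => /eqP.
rewrite eqf_sqr dotDl.
move: kA; rewrite dotBl subr_eq0 => /negbTE -> /= /eqP ->.
by rewrite addNr.
Qed.

Theorem corollary2p6 (R : realType) (n m : nat) (hn : (0 < n)%N) :
  (forall f : 'I_m -> 'cV[R]_n, spans f [set: 'I_m] ->
     [<-> injective (phi idfun f);
          cond_a f; cond_b idfun f; cond_c idfun f; cond_d idfun f])
  /\
  (forall f : 'I_m -> 'cV[R[i]]_n, spans f [set: 'I_m] ->
     [<-> cond_a f; cond_b Num.conj f; cond_c Num.conj f; cond_d Num.conj f]
     /\ (injective (phi Num.conj f) ->
           [/\ cond_a f, cond_b Num.conj f, cond_c Num.conj f
             & cond_d Num.conj f])).
Proof.
split=> f sf.
  have mulE (z : R) : z * idfun z = `|z| ^+ 2 by rewrite real_normK ?num_real.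
  have cjK : involutive (idfun : R -> R) by [].
  (* The cycle closes from (d) back to injectivity; (a) -> (b) passes through (c), and (b) -> (c)
     through (a). *)
  tfae.
  - exact: injective_cond_a.
  - by move=> /(cond_ac cjK mulE) /(cond_cb mulE).
  - by move=> /(cond_ba cjK) /(cond_ac cjK mulE).
  - by move/(cond_cd cjK mulE).
  - move=> /(cond_cd cjK mulE) /(cond_cb mulE) /(cond_ba cjK).
    exact: real_cond_a_injective.
have mulE (z : R[i]) : z * Num.conj z = `|z| ^+ 2 by rewrite normCK.
have cjK : involutive (Num.conj : R[i] -> R[i]) := conjCK.
split.
  tfae.
  - by move=> /(cond_ac cjK mulE) /(cond_cb mulE).
  - by move=> /(cond_ba cjK) /(cond_ac cjK mulE).
  - by move/(cond_cd cjK mulE).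
  - by move=> /(cond_cd cjK mulE) /(cond_cb mulE) /(cond_ba cjK).
move=> /(injective_cond_a cjK mulE sf) cA; have cC := cond_ac cjK mulE cA.
by split=> //; [apply: cond_cb | apply/cond_cd].
Qed.
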